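(* Let $K$ be a finite field with $q$ elements, let $w_1,w_2$ be positive integers with $\gcd(w_1,w_2)=1$, and let $Q=\langle w_1,w_2\rangle\subset\mathbb{N}$. The weighted projective Reed--Muller codes $C_{\mathbb{T}}(d)$ over the $1$-dimensional weighted torus $\mathbb{T}(w_1,w_2)$ are maximum distance separable codes, i.e., for every $d\in Q$, the minimum distance $\delta_{\mathbb{T}}(d)$ of $C_{\mathbb{T}}(d)$ satisfies $$\delta_{\mathbb{T}}(d)=(q-1)-\dim_K C_{\mathbb{T}}(d)+1.$$
   Context: $\mathbb{N}=\{0,1,2,\dots\}$. The weighted projective space $\mathbb{P}(w_1,w_2)$ is the quotient $(K^2\setminus 0)/K^*$, where $\lambda\in K^*$ acts by $\lambda(x_1,x_2)=(\lambda^{w_1}x_1,\lambda^{w_2}x_2)$. The weighted projective torus is $\mathbb{T}(w_1,w_2)=\{(x_1,x_2)\in\mathbb{P}(w_1,w_2): x_1x_2\neq 0\}$. The polynomial ring $K[t_1,t_2]$ is graded by $\deg(t_1)=w_1$, $\deg(t_2)=w_2$. Let $m=|\mathbb{T}(w_1,w_2)|$ and fix systems of homogeneous coordinates $\underline{x}_1,\dots,\underline{x}_m\in K^2$ of the points of $\mathbb{T}(w_1,w_2)$. For $d\geq 0$ let $\operatorname{ev}_d\colon K[t_1,t_2]_d\to K^m$ be $f\mapsto(f(\underline{x}_1),\dots,f(\underline{x}_m))$. The image of $\operatorname{ev}_d$ is $C_{\mathbb{T}}(d)$, the weighted projective Reed--Muller code over $\mathbb{T}(w_1,w_2)$ of order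 $d$. For a nonzero linear code $C\subset K^m$, the length is $m$ and the minimum distance is $\delta_C=\min\{\|\underline{x}\|:\underline{x}\in C\setminus 0\}$, where $\|\underline{x}\|$ is the number of nonzero components of $\underline{x}$. The code is maximum distance separable if equality holds in the singleton bound $\delta_C\leq\operatorname{length}(C)-\dim_K C+1$. $Q=\langle w_1,w_2\rangle$ is the submonoid of $\mathbb{N}$ generated by $w_1,w_2$; $C_{\mathbb{T}}(d)\neq 0$ if and only if $d\in Q$. The length of $C_{\mathbb{T}}(d)$ is $q-1$. *)

(* Defs.v *)
From HB Require Import structures.
From mathcomp Require Import all_boot all_fingroup all_algebra.
From mathcomp Require Import boolp.
From mathcomp Require Import mpoly.

Set Implicit Arguments.
Unset Strict Implicit.
Unset Printing Implicit Defensive.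

Import GRing.Theory.

Local Open Scope ring_scope.

Inductive submonoid_gen (S : pred nat) : nat -> Prop :=
| submonoid_gen_mem a of S a : submonoid_gen S a
| submonoid_gen_0 : submonoid_gen S 0
| submonoid_gen_add a b of submonoid_gen S a & submonoid_gen S b :
    submonoid_gen S (a + b)%N.

Section WeightedProjectiveSpace.
Variables (K : finFieldType) (n : nat) (w : n.-tuple nat).

Definition wact (x : 'rV[K]_n) (l : {unit K}) : 'rV[K]_n :=
  \row_i (val l ^+ tnth w i * x 0 i).

Fact wact1 : wact^~ 1%g =1 id.
Proof. by move=> x; apply/rowP => i; rewrite mxE expr1n mul1r. Qed.

Fact wactM x : act_morph wact x.
Proof.
move=> a b; apply/rowP => i; rewrite !mxE mulrA -exprMn.
by congr (_ ^+ _ * _); rewrite mulrC.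
Qed.

Definition waction : {action {unit K} &-> 'rV[K]_n} := TotalAction wact1 wactM.

(* A point is an orbit of the weighted action, hence a set of vectors. *)
Definition wpoint (x : 'rV[K]_n) : {set 'rV[K]_n} :=
  orbit waction [set: {unit K}] x.

Definition wproj : {set {set 'rV[K]_n}} := wpoint @: [set~ 0].

Definition wtorus : {set {set 'rV[K]_n}} :=
  [set P in wproj | [forall x in P, \prod_(i < n) x 0 i != 0]].

Definition torus_coordinates (m : nat) (x : 'I_m -> 'rV[K]_n) : Prop :=
  injective (wpoint \o x) /\ [set wpoint (x i) | i : 'I_m] = wtorus.

End WeightedProjectiveSpace.

Section WeightedDegree.
Variables (n : nat) (w : n.-tuple nat).

Definition wdeg (a : 'X_{1..n}) : nat := (\sum_(i < n) tnth w i * a i)%N.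

Fact wdeg0 : wdeg 0%MM = 0%N.
Proof. by rewrite /wdeg big1 // => i _; rewrite mnm0E muln0. Qed.

Fact wdegD : {morph wdeg : a b / (a + b)%MM >-> (a + b)%N}.
Proof.
by move=> a b; rewrite /wdeg -big_split; apply: eq_bigr => i _;
  rewrite mnmDE mulnDr.
Qed.

HB.instance Definition _ := isMeasure.Build n wdeg wdeg0 wdegD.

End WeightedDegree.

Section Code.
Variables (K : finFieldType) (n : nat) (w : n.-tuple nat).
Variables (m : nat) (x : 'I_m -> 'rV[K]_n).

Definition evmap (f : {mpoly K[n]}) : 'rV[K]_m := \row_i f.@[x i 0].

(* The span only packages the image of the degree-d part as a subspace: it adds
   no vector, see wprm_codeP. *)
Definition wprm_code (d : nat) : {vspace 'rV[K]_m} :=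
  <<[seq c <- enum 'rV[K]_m |
      `[< exists2 f : {mpoly K[n]}, f \is d.-homog for (wdeg w) & c = evmap f >]
    ]>>%VS.

Lemma wprm_codeP d (c : 'rV[K]_m) :
  c \in wprm_code d <->
  exists2 f : {mpoly K[n]}, f \is d.-homog for (wdeg w) & c = evmap f.
Proof.
split=> [|ex_f]; last first.
  by apply: memv_span; rewrite mem_filter mem_enum andbT; apply/asboolP.
rewrite /wprm_code; set s := [seq _ <- _ | _]; pose X := in_tuple s.
have -> : <<s>>%VS = <<X>>%VS by [].
move=> /coord_span ->.
elim/big_ind: _ => [|u v [f hf ->] [g hg ->]|i _].
- exists 0; first exact: rpred0.
  by apply/rowP => i; rewrite !mxE meval0.
- exists (f + g); first exact: rpredD.
  by apply/rowP => i; rewrite !mxE mevalD.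
have /= := mem_nth 0 (ltn_ord i).
rewrite mem_filter => /andP[/asboolP[f hf ef] _].
exists (coord X i c *: f); first exact: rpredZ.
by rewrite [X in _ *: X]ef; apply/rowP => j; rewrite !mxE mevalZ.
Qed.

End Code.

Section LinearCode.
Variables (K : finFieldType) (m : nat).
Implicit Types (c : 'rV[K]_m) (C : {vspace 'rV[K]_m}).

Definition hamming_weight c : nat := #|[set i | c 0 i != 0]|.

(* The default value m is never smaller than a weight, so it is immaterial
   unless C = 0. *)
Definition min_distance C : nat :=
  \big[minn/m]_(c in C | c != 0) hamming_weight c.

Lemma min_distance_le C c :
  c \in C -> c != 0 -> (min_distance C <= hamming_weight c)%N.
Proof.
move=> Cc c0; rewrite /min_distance.
have : c \in index_enum 'rV[K]_m by rewrite mem_index_enum.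
elim: index_enum => // a r IH; rewrite inE big_cons.
case: eqP => [<- _|_ /= /IH le_r]; first by rewrite Cc c0 geq_minl.
by case: ifP => // _; apply: leq_trans le_r; rewrite geq_minr.
Qed.

Lemma min_distance_attained C : C != 0%VS ->
  exists c, [/\ c \in C, c != 0 & hamming_weight c = min_distance C].
Proof.
move=> C0; have [lt_m|] := boolP (min_distance C < m)%N; last first.
  rewrite -leqNgt => ge_m.
  have c0 : vpick C != 0 by rewrite vpick0.
  exists (vpick C); rewrite memv_pick c0; split=> //; apply/eqP.
  rewrite eqn_leq min_distance_le ?memv_pick // andbT.
  by apply: leq_trans ge_m; rewrite -[X in (_ <= X)%N]card_ord max_card.
suff [E|//] : min_distance C = m \/ exists c,
    [/\ c \in C, c != 0 & hamming_weight c = min_distance C].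
  by rewrite E ltnn in lt_m.
rewrite /min_distance; apply: (big_ind (fun k => k = m \/ exists c,
    [/\ c \in C, c != 0 & hamming_weight c = k])) => [|a b Ha Hb|c].
- by left.
- by case: (leqP a b) => _.
- by case/andP=> Cc c0; right; exists c.
Qed.

Definition mds C : Prop :=
  C != 0%VS /\ (min_distance C)%:Z = m%:Z - (\dim C)%:Z + 1.

End LinearCode.

(* Main.v *)
(** On the torus the function [x1 ^ w2 / x2 ^ w1] is invariant under the weighted
    action, and since [gcd(w1, w2) = 1] it is a bijection onto [K^*].  The
    monomials of degree [d] are [x1 ^ a0 * x2 ^ b0] times the first powers of
    this function, with [a0] minimal; hence the code is a generalized
    Reed-Solomon code with evaluation points [K^*], and a nonzero polynomial of
    degree less than [k] has at most [k - 1] zeros. *)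
Require Import Defs.
From HB Require Import structures.
From mathcomp Require Import all_boot all_fingroup all_algebra finfield zify.
From mathcomp Require Import mpoly.

Set Implicit Arguments.
Unset Strict Implicit.
Unset Printing Implicit Defensive.

Local Open Scope ring_scope.

Import GRing.Theory.

(** * Generalized Reed-Solomon codes: dimension, minimum distance, MDS property *)

Section EvaluationCode.
Variables (K : finFieldType) (m : nat) (u y : 'I_m -> K).
Hypotheses (y_inj : injective y) (u_neq0 : forall i, u i != 0).

(** The generalized Reed-Solomon codeword of [g], with evaluation points [y] and column multipliers
    [u]. *)
Definition grs (g : {poly K}) : 'rV[K]_m := \row_i (u i * g.[y i]).

Lemma hamming_weight0 : hamming_weight (0 : 'rV[K]_m) = 0%N.
Proof. by apply: eq_card0 => i; rewrite !inE mxE eqxx. Qed.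

Lemma hamming_weightE (c : 'rV[K]_m) :
  (hamming_weight c + #|[set i | c 0%R i == 0%R]| = m)%N.
Proof.
rewrite -[RHS](card_ord m) -(cardsC [set i | c 0 i == 0]) addnC.
by congr (_ + _)%N; apply: eq_card => i; rewrite !inE.
Qed.

(** As the [u i] are nonzero and the [y i] distinct, the zero coordinates of the codeword give
    distinct roots of [g], fewer than [size g] in number. *)
Lemma hamming_weight_grs g : g != 0 -> (m < hamming_weight (grs g) + size g)%N.
Proof.
move=> g0; set Z := [set i | grs g 0 i == 0].
have := max_poly_roots (rs := [seq y i | i <- enum Z]) g0.
rewrite size_map -cardE => le_Z; rewrite -[X in (X < _)%N](hamming_weightE (grs g)).
rewrite ltn_add2l; apply: le_Z; last by rewrite map_inj_uniq ?enum_uniq.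
apply/allP => _ /mapP[i + ->]; rewrite mem_enum inE mxE mulf_eq0.
by rewrite (negPf (u_neq0 i)).
Qed.

Lemma grsB g h : grs (g - h) = grs g - grs h.
Proof. by apply/rowP => i; rewrite !mxE hornerD hornerN mulrBr. Qed.

Lemma grs_inj : {in [pred g : {poly K} | size g <= m]%N &, injective grs}.
Proof.
move=> g h; rewrite !inE => gm hm gh; apply/eqP; rewrite -subr_eq0.
apply/negPn/negP => /hamming_weight_grs.
rewrite grsB gh subrr hamming_weight0 add0n ltnNge.
by rewrite (leq_trans (size_polyD _ _)) // size_polyN geq_max gm hm.
Qed.

(** Root counting makes evaluation injective, which gives the dimension, and bounds the weights from
    below; a product of [k - 1] linear factors attains the bound. *)
Lemma grs_dim_distance k (C : {vspace 'rV[K]_m}) :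
    (0 < k <= m)%N ->
    (forall c, c \in C <-> exists2 g : {poly K}, (size g <= k)%N & c = grs g) ->
  (\dim C = k /\ min_distance C = (m - k).+1)%N.
Proof.
move=> /andP[k0 km] CE.
have dimC : \dim C = k.
  (* The dimension is read off from the cardinality: [C] is in bijection with the coefficient
     vectors of length [k]. *)
  apply: (@expnI #|K|); first exact: card_finRing_gt1.
  rewrite -card_vspace -[k in RHS]mul1n -card_mx.
  have inj_ev : injective (fun v : 'rV[K]_k => grs (rVpoly v)).
    move=> v v' /grs_inj E; apply: (can_inj rVpolyK); apply: E;
    by rewrite inE (leq_trans (size_poly _ _)).
  rewrite -(card_imset _ inj_ev); apply: eq_card => c.
  apply/idP/imsetP => [/CE[g gk ->]|[v _ ->]].
    by exists (poly_rV g); rewrite ?poly_rV_K.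
  by apply/CE; exists (rVpoly v); rewrite ?size_poly.
split=> //; apply/eqP; rewrite eqn_leq; apply/andP; split; last first.
  have C0 : C != 0%VS by rewrite -dimv_eq0 dimC -lt0n.
  have [c [Cc c0 <-]] := min_distance_attained C0.
  have [g gk cE] := (CE c).1 Cc.
  have g0 : g != 0.
    apply: contraNneq c0 => g0; rewrite cE g0.
    by apply/eqP/rowP => i; rewrite !mxE horner0 mulr0.
  have := hamming_weight_grs g0; rewrite -cE => lt_m.
  by rewrite ltn_subLR // addnC (leq_trans lt_m) ?leq_add2l.
(* Prescribing [k - 1] zeros makes the product [g] below have size exactly [k]. *)
pose r := take k.-1 (enum 'I_m).
have r_size : size r = k.-1.
  by rewrite size_take size_enum_ord; case: ltngtP km => //; case: (k) k0 => // n _; lia.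
pose g : {poly K} := \prod_(i <- r) ('X - (y i)%:P).
have g_size : size g = k by rewrite size_prod_XsubC r_size prednK.
have g0 : g != 0 by rewrite -size_poly_eq0 g_size -lt0n.
have Cg : grs g \in C by apply/CE; exists g; rewrite ?g_size.
have cg0 : grs g != 0.
  apply: contraTneq (hamming_weight_grs g0) => ->.
  by rewrite hamming_weight0 g_size -leqNgt.
apply: leq_trans (min_distance_le Cg cg0) _.
rewrite -(leq_add2r #|[set i | grs g 0 i == 0]|) hamming_weightE.
have : (k.-1 <= #|[set i | grs g 0%R i == 0%R]|)%N.
  rewrite -r_size -(card_uniqP (take_uniq _ (enum_uniq _))).
  apply/subset_leq_card/subsetP => i ir; rewrite inE mxE mulf_eq0.
  by rewrite -/(root g (y i)) /g -(big_map y xpredT (fun a => 'X - a%:P))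
             root_prod_XsubC map_f ?orbT.
rewrite -(leq_add2l (m - k).+1); apply: leq_trans.
by rewrite addSnnS prednK // subnK.
Qed.

(** The modulus vanishes at every evaluation point. *)
Lemma grs_modp (g : {poly K}) :
  grs (g %% \prod_i ('X - (y i)%:P)) = grs g.
Proof.
apply/rowP => i; rewrite !mxE; congr (_ * _).
rewrite [in RHS](divp_eq g (\prod_i ('X - (y i)%:P))) hornerD hornerM.
by rewrite (bigD1 i) //= hornerM hornerXsubC subrr mul0r mulr0 add0r.
Qed.

Lemma grs_mds k (C : {vspace 'rV[K]_m}) :
    (0 < k)%N -> (0 < m)%N ->
    (forall c, c \in C <-> exists2 g : {poly K}, (size g <= k)%N & c = grs g) ->
  mds C.
Proof.
move=> k0 m0 CE.
(* Polynomials of size above [m] give no new codewords, so the dimension is [minn k m]. *)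
have km : (0 < minn k m <= m)%N by rewrite leq_min k0 m0 geq_minr.
have [|dimC distC] := @grs_dim_distance (minn k m) C km.
  move=> c; split=> [/CE[g gk ->]|[g]]; last first.
    by rewrite leq_min => /andP[gk _] ->; apply/CE; exists g.
  have [gm|gm] := leqP (size g) m; first by exists g; rewrite ?leq_min ?gk.
  exists (g %% \prod_i ('X - (y i)%:P)); last by rewrite grs_modp.
  (* Here [m < size g <= k]; the modulus has size [m + 1], so the remainder has size at most [m]. *)
  rewrite (minn_idPr _) ?(leq_trans (ltnW gm)) // -ltnS.
  have <- : size (\prod_i ('X - (y i)%:P)) = m.+1.
    by rewrite size_prod_XsubC -[index_enum _]enumT size_enum_ord.
  by rewrite ltn_modp monic_neq0 ?monic_prod_XsubC.
have /andP[k'0 k'm] := km.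
split; first by rewrite -dimv_eq0 dimC -lt0n.
by rewrite distC dimC subzn // -PoszD addn1.
Qed.

End EvaluationCode.

Lemma lift0_ord0 : lift ord0 ord0 = 1 :> 'I_2.
Proof. exact: val_inj. Qed.

(** * Identification of the torus with the nonzero scalars *)

Section WeightedTorusDim1.
Variables (K : finFieldType) (w1 w2 : nat).
Hypotheses (w1_gt0 : (0 < w1)%N) (w2_gt0 : (0 < w2)%N).
Hypothesis w_coprime : gcdn w1 w2 = 1%N.
Local Notation w := [tuple w1; w2].
Implicit Types (p r : 'rV[K]_2).

Definition torus_ratio p : K := p 0 0 ^+ w2 / p 0 1 ^+ w1.

Lemma torus_ratioP p r : p 0 0 != 0 -> p 0 1 != 0 -> r 0 0 != 0 -> r 0 1 != 0 ->
  wpoint w p = wpoint w r <-> torus_ratio p = torus_ratio r.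
Proof.
move=> p0 p1 r0 r1; split=> [E|].
  have : p \in wpoint w r by rewrite -E orbit_refl.
  case/orbitP => l _ <- /=.
  have l0 : val l != 0 by rewrite -unitfE; exact: (valP l).
  rewrite /torus_ratio !mxE /tnth /= !exprMn -!exprM mulnC.
  by rewrite -mulf_div divff ?expf_neq0 // mul1r.
(* Bezout gives [s * w1 = t * w2 + 1]. Since [a ^+ w2 = b ^+ w1], the scalar [a ^+ s / b ^+ t] has
   [w1]-th power [a] and [w2]-th power [b], so it carries [r] to [p]. *)
move=> E; have [s t st _] := egcdnP w2 w1_gt0; rewrite w_coprime in st.
pose a := p 0 0 / r 0 0; pose b := p 0 1 / r 0 1.
have a0 : a != 0 by rewrite mulf_neq0 ?invr_eq0.
have b0 : b != 0 by rewrite mulf_neq0 ?invr_eq0.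
have ab : a ^+ w2 = b ^+ w1.
  move/eqP: E; rewrite /torus_ratio eqr_div ?expf_neq0 // => /eqP E.
  rewrite !expr_div_n; apply/eqP; rewrite eqr_div ?expf_neq0 //; apply/eqP.
  by rewrite E mulrC.
have l0 : a ^+ s / b ^+ t \is a GRing.unit.
  by rewrite unitfE mulf_neq0 ?invr_eq0 ?expf_neq0.
have la : (a ^+ s / b ^+ t) ^+ w1 = a.
  rewrite expr_div_n -!exprM st (mulnC t w1) exprM -ab -exprM mulnC addnC exprS.
  by rewrite mulfK ?expf_neq0 // expf_neq0.
have lb : (a ^+ s / b ^+ t) ^+ w2 = b.
  rewrite expr_div_n -!exprM (mulnC s) exprM ab -exprM mulnC st addnC exprS.
  by rewrite mulfK ?expf_neq0.
apply/orbit_eqP/orbitP; exists (FinRing.unit K l0); rewrite ?inE //=.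
apply/rowP => i; rewrite !mxE.
case: (splitP (i : 'I_(1 + 1))) => j; rewrite ord1 => Ei.
  have -> : i = 0 by apply: val_inj.
  by rewrite /tnth /= la divfK.
have -> : i = 1 by apply: val_inj.
by rewrite /tnth /= lb divfK.
Qed.

(** The action multiplies each coordinate by a nonzero factor, so one representative decides. *)
Lemma wpoint_torus p : (wpoint w p \in wtorus K w) = (p 0 0 != 0) && (p 0 1 != 0).
Proof.
rewrite inE; apply/andP/idP => [[_ /forall_inP/(_ p (orbit_refl _ _ _))]|/andP[p0 p1]].
  by rewrite big_ord_recl big_ord1 lift0_ord0 mulf_eq0 negb_or.
split.
  apply/imsetP; exists p => //; rewrite !inE.
  by apply: contraNneq p0 => ->; rewrite mxE.
apply/forall_inP => r /orbitP[l _ <-].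
have l0 : val l != 0 by rewrite -unitfE; exact: (valP l).
have p_neq0 i : p 0 i != 0.
  by case: i => [[|[|//]]] Hi; [move: p0 | move: p1];
    congr (is_true (p _ _ != _)); apply: val_inj.
by apply/prodf_neq0 => i _; rewrite mxE mulf_neq0 ?expf_neq0.
Qed.

Lemma torus_ratio_surj (t : K) : t != 0 ->
  exists p, [/\ p 0 0 != 0, p 0 1 != 0 & torus_ratio p = t].
Proof.
(* Here [a * w1 = b * w2 + 1], so coordinates [t ^- b] and [t ^- a] have ratio [t] to the power
   [a * w1 - b * w2 = 1]. *)
move=> t0; have [a b ab _] := egcdnP w2 w1_gt0; rewrite w_coprime in ab.
exists (\row_i (if i == 0 then t ^- b else t ^- a)); rewrite /torus_ratio !mxE /=.
rewrite !invr_eq0 !expf_neq0 //; split=> //.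
by rewrite !exprVn invrK -!exprM ab addn1 exprS mulrC mulfK ?expf_neq0.
Qed.

(** * Monomials of a given weighted degree and their evaluation *)

Lemma submonoid_gen2P d : submonoid_gen (pred2 w1 w2) d ->
  exists a b, d = (w1 * a + w2 * b)%N.
Proof.
elim=> [e /orP[]/eqP->||_ _ _ [a [b ->]] _ [a' [b' ->]]].
- by exists 1%N, 0%N; rewrite muln1 muln0 addn0.
- by exists 0%N, 1%N; rewrite muln1 muln0.
- by exists 0%N, 0%N; rewrite !muln0.
by exists (a + a')%N, (b + b')%N; rewrite !mulnDr addnACA.
Qed.

Lemma wdeg2E (e : 'X_{1..2}) : wdeg w e = (w1 * e 0%R + w2 * e 1%R)%N.
Proof. by rewrite /wdeg big_ord_recl big_ord1 lift0_ord0. Qed.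

(** By coprimality two solutions differ by a multiple of [(w2, - w1)]; [a0 < w2] makes [a0] the
    least first entry, and the bound on [k] keeps the second one nonnegative. *)
Lemma wdeg2_progression a0 b0 a b : (a0 < w2)%N ->
  (w1 * a + w2 * b = w1 * a0 + w2 * b0)%N <->
  exists2 k, (k <= b0 %/ w1)%N & (a = a0 + k * w2 /\ b = b0 - k * w1)%N.
Proof.
move=> a0_lt; split=> [E|[k + [-> ->]]]; last by rewrite leq_divRL //; nia.
(* Otherwise [w2] would divide [a0 - a], a positive number below [w2]. *)
have le_a : (a0 <= a)%N.
  rewrite leqNgt; apply/negP => lt_a.
  have lt_b : (b0 <= b)%N by nia.
  have : (w2 %| a0 - a)%N.
    rewrite -(@Gauss_dvdr _ w1); last by rewrite /coprime gcdnC w_coprime.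
    by apply/dvdnP; exists (b - b0)%N; nia.
  by move/dvdn_leq; rewrite subn_gt0 => /(_ lt_a); lia.
have : (w2 %| a - a0)%N.
  rewrite -(@Gauss_dvdr _ w1); last by rewrite /coprime gcdnC w_coprime.
  by apply/dvdnP; exists (b0 - b)%N; nia.
case/dvdnP=> k Ek; exists k; rewrite ?leq_divRL //; last split; nia.
Qed.

(** Each monomial of this degree evaluates to the fixed multiplier times the [k]-th power of the
    ratio, so it corresponds to the univariate monomial of degree [k]. *)
Lemma evmap_homog2 m (x : 'I_m -> 'rV[K]_2) a0 b0 (c : 'rV[K]_m) :
    (a0 < w2)%N -> (forall i, x i 0 0 != 0) -> (forall i, x i 0 1 != 0) ->
  (exists2 f : {mpoly K[2]},
     f \is (w1 * a0 + w2 * b0)%N.-homog for (wdeg w) & c = evmap x f) <->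
  (exists2 g : {poly K}, (size g <= (b0 %/ w1).+1)%N &
     c = grs (fun i => x i 0 0 ^+ a0 * x i 0 1 ^+ b0) (torus_ratio \o x) g).
Proof.
move=> a0_lt x0 x1.
have mono i k : (k <= b0 %/ w1)%N ->
    x i 0 0 ^+ (a0 + k * w2) * x i 0 1 ^+ (b0 - k * w1) =
    x i 0 0 ^+ a0 * x i 0 1 ^+ b0 * torus_ratio (x i) ^+ k.
  rewrite leq_divRL // => le_k; rewrite expr_div_n -!exprM exprD.
  rewrite expfB_cond ?(negPf (x1 i)) // (mulnC k) (mulnC k).
  by rewrite mulrACA.
split=> [[f hf ->]|[g g_size ->]].
  (* The first exponent of [e] is [a0 + k * w2], so this quotient recovers [k]. *)
  exists (\sum_(e <- msupp f) f@_e *: 'X^((e 0%R - a0) %/ w2)).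
    rewrite (leq_trans (size_sum _ _ _)) //; apply/bigmax_leqP_seq => e ef _.
    rewrite (leq_trans (size_scale_leq _ _)) // size_polyXn ltnS.
    move/dhomogP: hf => /(_ e ef) /=; rewrite wdeg2E.
    by case/wdeg2_progression=> // k ? [-> _]; rewrite addKn mulnK.
  apply/rowP => i; rewrite !mxE mevalE horner_sum mulr_sumr.
  apply: eq_big_seq => e ef; rewrite big_ord_recl big_ord1 lift0_ord0 hornerZ hornerXn.
  rewrite [RHS]mulrCA; congr (_ * _).
  move/dhomogP: hf => /(_ e ef) /=; rewrite wdeg2E.
  case/wdeg2_progression=> // k le_k [Ea Eb].
  by rewrite Ea Eb addKn mulnK // mono.
(* The range of [k] ensures that the truncated subtraction is exact. *)
pose e k := [multinom (if i == 0%R :> 'I_2 then a0 + k * w2 else b0 - k * w1)%N | i < 2].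
exists (\sum_(k < (b0 %/ w1).+1) g`_k *: 'X_[e k]).
  apply: rpred_sum => k _; apply: rpredZ; rewrite dhomogX /= wdeg2E !mnmE /=.
  by apply/eqP/wdeg2_progression => //; exists k => //; rewrite -ltnS.
apply/rowP => i; rewrite !mxE raddf_sum (horner_coef_wide _ g_size) mulr_sumr.
apply: eq_bigr => k _; rewrite /= mevalZ mevalX big_ord_recl big_ord1 lift0_ord0 !mnmE /=.
by rewrite mulrCA mono // -ltnS.
Qed.

(** * Coordinate systems on the torus and the length of the code *)

Section TorusCoordinates.
Variables (m : nat) (x : 'I_m -> 'rV[K]_2).
Hypothesis hx : torus_coordinates w x.

Lemma torus_coordinates_neq0 i : x i 0 0 != 0 /\ x i 0 1 != 0.
Proof. by apply/andP; rewrite -wpoint_torus -hx.2; apply/imsetP; exists i. Qed.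

Lemma torus_ratio_inj : injective (torus_ratio \o x).
Proof.
move=> i j E; apply: hx.1; have [? ?] := torus_coordinates_neq0 i.
by have [? ?] := torus_coordinates_neq0 j; apply/torus_ratioP.
Qed.

(** The ratio maps the indices bijectively onto the nonzero elements of [K]. *)
Lemma torus_coordinates_length : m = #|K|.-1.
Proof.
rewrite -[LHS](card_ord m) -(card_imset _ torus_ratio_inj) -(cardsC1 0).
apply: eq_card => t; rewrite !inE; apply/imsetP/idP => [[i _ ->]|t0].
  have [? ?] := torus_coordinates_neq0 i.
  by rewrite mulf_neq0 ?invr_eq0 ?expf_neq0.
have [p [p0 p1 <-]] := torus_ratio_surj t0.
have : wpoint w p \in wtorus K w by rewrite wpoint_torus p0.
rewrite -hx.2 => /imsetP[i _ E]; exists i => //; apply/torus_ratioP => //.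
- by have [] := torus_coordinates_neq0 i.
- by have [] := torus_coordinates_neq0 i.
Qed.

End TorusCoordinates.

End WeightedTorusDim1.

Theorem corollary4p5 (K : finFieldType) (w1 w2 : nat)
    (w1_gt0 : (0 < w1)%N) (w2_gt0 : (0 < w2)%N) (w_coprime : gcdn w1 w2 = 1%N)
    (x : 'I_#|wtorus K [tuple w1; w2]| -> 'rV[K]_2)
    (hx : torus_coordinates [tuple w1; w2] x)
    (d : nat) (dQ : submonoid_gen (pred2 w1 w2) d) :
  let C := wprm_code [tuple w1; w2] x d in
  mds C /\
  (min_distance C)%:Z = (#|K|%:Z - 1) - (\dim C)%:Z + 1.
Proof.
move=> C; have K_gt1 := card_finRing_gt1 K.
have mE := torus_coordinates_length w1_gt0 w_coprime hx.
(* With length [#|K| - 1], the second claim is the MDS equality itself. *)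
suff C_mds : mds C.
  by split=> //; rewrite C_mds.2 {1}mE -subn1 -subzn // ltnW.
have [a [b dE]] := submonoid_gen2P dQ.
(* Multiples of [w2] move from the first exponent into the second, leaving a first exponent below
   [w2], as [evmap_homog2] requires. *)
have {}dE : d = (w1 * (a %% w2) + w2 * (b + w1 * (a %/ w2)))%N.
  by rewrite dE {1}(divn_eq a w2); lia.
have x0 := torus_coordinates_neq0 hx.
apply: (@grs_mds K _ (fun i => x i 0 0 ^+ (a %% w2)
    * x i 0 1 ^+ (b + w1 * (a %/ w2))) (torus_ratio w1 w2 \o x) _ _
  ((b + w1 * (a %/ w2)) %/ w1).+1) => //.
- exact: torus_ratio_inj.
- by move=> i; have [? ?] := x0 i; rewrite mulf_neq0 ?expf_neq0.
- by rewrite mE -ltnS prednK // ltnW.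
move=> c; rewrite -evmap_homog2 ?ltn_mod //; try by move=> i; have [] := x0 i.
by rewrite -dE; apply: wprm_codeP.
Qed.
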